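(* Let $(A,\diamond,D,Q)$ be an admissible differential Zinbiel algebra, $q\in\mathbf{k}$, and let $(A,\cdot,D,Q)$ be the descendent admissible commutative differential algebra. (a) Let $(A,\lhd_q,\rhd_q)$ be the pre-Novikov algebra given by $a\lhd_q b=(D+qQ)(b)\diamond a$, $a\rhd_q b=a\diamond(D+qQ)(b)$, and let $(A,\circ_q)$ be the Novikov algebra induced from $(A,\cdot,D,Q)$, $a\circ_q b=a\cdot(D+qQ)(b)$. Let $\{e_1,\ldots,e_n\}$ be a basis of $A$, $\{e_1^*,\ldots,e_n^*\}$ the dual basis of $A^*$, and $$r:=\sum_{i=1}^n(e_i\otimes e_i^*-e_i^*\otimes e_i).$$ Then there is a Novikov bialgebra $(A\ltimes_{L_{\rhd_q}^*+R_{\lhd_q}^*,\,-R_{\lhd_q}^*}A^*,\circ,\Delta)$, where $\Delta(x)=(L_\circ(x)\otimes\mathrm{id}+\mathrm{id}\otimes L_\star(x))r$ for $x\in A\oplus A^*$. (b) There is a commutative and cocommutative differential ASI bialgebra $(A\ltimes_{-L_\diamond^*}A^*,\cdot,\delta,D+Q^*,Q+D^* )$, where $\delta(x)=-(\mathrm{id}\otimes L_\cdot(x)-L_\cdot(x)\otimes\mathrm{id})r$ for $x\in A\oplus A^*$. (c) If $q=-\frac12$ or $Q$ is a derivation on $(A,\diamond)$, then there is a Novikov bialgebra $(A\oplus A^*,\circ_q,\Delta_q)$ obtained from $(A\ltimes_{-L_\diamond^*}A^*,\cdot,\delta,D+Q^*,Q+D^* )$ by $$x\circ_q y=x\cdot\big((D+Q^*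 )+q(Q+D^* )\big)(y),\qquad\Delta_q(x)=\big(\mathrm{id}\otimes((Q+D^* )+q(D+Q^* ))\big)\delta(x),\qquad x,y\in A\oplus A^*,$$ and it coincides with $(A\ltimes_{L_{\rhd_q}^*+R_{\lhd_q}^*,\,-R_{\lhd_q}^*}A^*,\circ,\Delta)$.
   Context: $\mathbf{k}$ is a field of characteristic $0$; all vector spaces are over $\mathbf{k}$ and finite-dimensional. $\tau(x\otimes y)=y\otimes x$; $L_*(a)b=a*b$, $R_*(a)b=b*a$. Duals: for a linear map $\varphi:A\to A$, $\varphi^*$ on $A^*$ is the transpose $\langle\varphi^*(f),v\rangle=\langle f,\varphi(v)\rangle$ (used for $D^*,Q^*$). For a linear map $\varphi:A\to\mathrm{End}_{\mathbf{k}}(V)$, $\varphi^*:A\to\mathrm{End}_{\mathbf{k}}(V^* )$ is $\langle\varphi^*(a)f,v\rangle=-\langle f,\varphi(a)v\rangle$ (used for $L_\diamond^*,L_{\rhd_q}^*,R_{\lhd_q}^*$). On $A\oplus A^*$: $(D+Q^* )(a+f)=D(a)+Q^*(f)$, $(Q+D^* )(a+f)=Q(a)+D^*(f)$. Zinbiel algebra $(A,\diamond)$: $a\diamond(b\diamond c)=(b\diamond a)\diamond c+(a\diamond b)\diamond c$. Admissible differential Zinbiel algebra $(A,\diamond,D,Q)$: Zinbiel algebra with linear $D,Q$ such that $D(a\diamond b)=a\diamond D(b)+D(a)\diamond b$ and $Q(a\diamond b)=Q(a)\diamond b-a\diamond D(b)=a\diamond Q(b)-D(a)\diamond b$. Its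 descendent admissible commutative differential algebra is $(A,\cdot,D,Q)$ with $a\cdot b=a\diamond b+b\diamond a$. ''$Q$ is a derivation on $(A,\diamond)$'' means $Q(a\diamond b)=Q(a)\diamond b+a\diamond Q(b)$. Pre-Novikov algebra $(A,\lhd,\rhd)$: $a\rhd(b\rhd c)=(a\rhd b+a\lhd b)\rhd c+b\rhd(a\rhd c)-(b\rhd a+b\lhd a)\rhd c$; $a\rhd(b\lhd c)=(a\rhd b)\lhd c+b\lhd(a\lhd c+a\rhd c)-(b\lhd a)\lhd c$; $(a\lhd b+a\rhd b)\rhd c=(a\rhd c)\lhd b$; $(a\lhd b)\lhd c=(a\lhd c)\lhd b$. Semi-direct products: $A\ltimes_{-L_\diamond^*}A^*$ is $A\oplus A^*$ with $(a+f)\cdot(b+g)=a\cdot b-L_\diamond^*(a)g-L_\diamond^*(b)f$. $A\ltimes_{L_{\rhd_q}^*+R_{\lhd_q}^*,-R_{\lhd_q}^*}A^*$ is $A\oplus A^*$ with $(a+f)\circ(b+g)=a\circ_q b+(L_{\rhd_q}^*+R_{\lhd_q}^* )(a)g-R_{\lhd_q}^*(b)f$. Novikov algebra $(A,\circ)$: $(a\circ b)\circ c-a\circ(b\circ c)=(b\circ a)\circ c-b\circ(a\circ c)$, $(a\circ b)\circ c=(a\circ c)\circ b$; $a\star b=a\circ b+b\circ a$. Novikov coalgebra $(A,\Delta)$: $(\mathrm{id}\otimes\Delta)\Delta(a)-(\tau\otimes\mathrm{id})(\mathrm{id}\otimes\Delta)\Delta(a)=(\Delta\otimes\mathrm{id})\Delta(a)-(\tau\otimes\mathrm{id})(\Delta\otimes\mathrm{id})\Delta(a)$,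 $(\tau\otimes\mathrm{id})(\mathrm{id}\otimes\Delta)\tau\Delta(a)=(\Delta\otimes\mathrm{id})\Delta(a)$. Novikov bialgebra $(A,\circ,\Delta)$: Novikov algebra and Novikov coalgebra with, for all $a,b$: $\Delta(a\circ b)=(R_\circ(b)\otimes\mathrm{id})\Delta(a)+(\mathrm{id}\otimes L_\star(a))(\Delta(b)+\tau\Delta(b))$; $(L_\star(a)\otimes\mathrm{id})\Delta(b)-(\mathrm{id}\otimes L_\star(a))\tau\Delta(b)=(L_\star(b)\otimes\mathrm{id})\Delta(a)-(\mathrm{id}\otimes L_\star(b))\tau\Delta(a)$; $(\mathrm{id}\otimes R_\circ(a)-R_\circ(a)\otimes\mathrm{id})(\Delta(b)+\tau\Delta(b))=(\mathrm{id}\otimes R_\circ(b)-R_\circ(b)\otimes\mathrm{id})(\Delta(a)+\tau\Delta(a))$. Commutative and cocommutative differential ASI bialgebra $(A,\cdot,\delta,D,Q)$: (1) $(A,\cdot)$ commutative associative, $D$ a derivation, $Q$ linear with $Q(a\cdot b)=Q(a)\cdot b-a\cdot D(b)$; (2) $\delta$ coassociative, $\delta=\tau\delta$, $\delta Q=(\mathrm{id}\otimes Q+Q\otimes\mathrm{id})\delta$, $\delta D=(D\otimes\mathrm{id}-\mathrm{id}\otimes Q)\delta$; (3) $(A,\cdot,\delta)$ is an ASI bialgebra: $\delta(a\cdot b)=(\mathrm{id}\otimes L_\cdot(a))\delta(b)+(R_\cdot(b)\otimes\mathrm{id})\delta(a)$ and $(L_\cdot(b)\otimes\mathrm{id}-\mathrm{id}\otimes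 R_\cdot(b))\delta(a)+\tau((L_\cdot(a)\otimes\mathrm{id}-\mathrm{id}\otimes R_\cdot(a))\delta(b))=0$. *)

(* Defs.v *)
From HB Require Import structures.
From mathcomp Require Import all_boot all_order all_algebra.
Set Implicit Arguments.
Unset Strict Implicit.
Unset Printing Implicit Defensive.
Import GRing.Theory.
Local Open Scope ring_scope.

(* The field is arbitrary here; characteristic 0 is a hypothesis of the
   theorem. Operations and linear maps are plain functions, and (bi)linearity
   is part of each predicate on structures. *)

Section TensorProduct.

Variable K : fieldType.
Implicit Types U V W X : vectType K.

Definition bilinear_map U V W (B : U -> V -> W) : Prop :=
  bilinear_for *:%R *:%R B.

(* The tensor product of finite-dimensional spaces: the coefficient matrices
   with respect to the bases vbasis {:V} and vbasis {:W}. It is used only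
   through tens and tens_lift, whose universal property is given by
   tens_bilinear, tens_liftE, tens_lift_linear and tens_ext below. *)
Definition tensor V W : vectType K := 'M[K]_(\dim {:V}, \dim {:W}).

Definition tens V W (x : V) (y : W) : tensor V W :=
  \matrix_(i, j) (coord (vbasis {:V}) i x * coord (vbasis {:W}) j y).

(* The linear map on tensor V W sending tens x y to B x y, B bilinear. *)
Definition tens_lift V W X (B : V -> W -> X) (t : tensor V W) : X :=
  \sum_i \sum_j (t : 'M_(_, _)) i j *: B (vbasis {:V})`_i (vbasis {:W})`_j.

Lemma tens_bilinear V W : bilinear_map (@tens V W).
Proof.
split=> [y a x x' | x a y y'] /=; apply/matrixP=> i j; rewrite !mxE linearP /=.
  by rewrite mulrDl -mulrA.
by rewrite mulrDr mulrCA.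
Qed.

Lemma bilinear_map_suml U V W (B : U -> V -> W) (I : finType) (c : I -> K) u y :
  bilinear_map B ->
  B (\sum_(i : I) c i *: u i) y = \sum_i c i *: B (u i) y.
Proof.
case=> Bl _; pose By z := B z y.
have By_lin : linear By by move=> a z z'; exact: Bl.
pose L := GRing.isLinear.Build K U W *:%R By By_lin.
pose f : {linear U -> W} := HB.pack By L.
by rewrite -[LHS]/(f _) linear_sum; apply: eq_bigr => i _; rewrite linearZ.
Qed.

Lemma bilinear_map_sumr U V W (B : U -> V -> W) (I : finType) (c : I -> K) u x :
  bilinear_map B ->
  B x (\sum_(i : I) c i *: u i) = \sum_i c i *: B x (u i).
Proof.
case=> _ Br; have Bx_lin : linear (B x) by move=> a z z'; exact: Br.
pose L := GRing.isLinear.Build K V W *:%R (B x) Bx_lin.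
pose f : {linear V -> W} := HB.pack (B x) L.
by rewrite -[LHS]/(f _) linear_sum; apply: eq_bigr => i _; rewrite linearZ.
Qed.

Lemma tens_liftE V W X (B : V -> W -> X) x y :
  bilinear_map B -> tens_lift B (tens x y) = B x y.
Proof.
move=> hB.
rewrite [in RHS](coord_vbasis (memvf x)) [in RHS](coord_vbasis (memvf y)).
rewrite bilinear_map_suml //; apply: eq_bigr => i _.
rewrite bilinear_map_sumr // scaler_sumr; apply: eq_bigr => j _.
by rewrite mxE scalerA.
Qed.

Lemma tens_lift_linear V W X (B : V -> W -> X) : linear (tens_lift B).
Proof.
move=> a s t; rewrite /tens_lift scaler_sumr -big_split /=.
apply: eq_bigr => i _; rewrite scaler_sumr -big_split /=.
by apply: eq_bigr => j _; rewrite !mxE scalerDl scalerA.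
Qed.

Lemma tens_ext V W X (f g : tensor V W -> X) : linear f -> linear g ->
  (forall x y, f (tens x y) = g (tens x y)) -> forall t, f t = g t.
Proof.
move=> fL gL fg t.
pose f' : {linear tensor V W -> X} :=
  HB.pack f (GRing.isLinear.Build K _ X *:%R f fL).
pose g' : {linear tensor V W -> X} :=
  HB.pack g (GRing.isLinear.Build K _ X *:%R g gL).
have -> : t = \sum_i \sum_j (t : 'M_(_, _)) i j *:
                tens (vbasis {:V})`_i (vbasis {:W})`_j.
  have bV := basis_free (vbasisP {:V}); have bW := basis_free (vbasisP {:W}).
  rewrite {1}[t]matrix_sum_delta; apply: eq_bigr => i _; apply: eq_bigr => j _.
  congr (_ *: _); apply/matrixP=> k l.
  by rewrite !mxE !coord_free // -natrM mulnb (eq_sym i) (eq_sym j).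
rewrite -[LHS]/(f' _) -[RHS]/(g' _) !linear_sum; apply: eq_bigr => i _.
rewrite !linear_sum; apply: eq_bigr => j _; rewrite !linearZ /=.
by congr (_ *: _); exact: fg.
Qed.

Definition tmap U V W X (f : U -> W) (g : V -> X) : tensor U V -> tensor W X :=
  tens_lift (fun x y => tens (f x) (g y)).

Definition tau V W : tensor V W -> tensor W V :=
  tens_lift (fun x y => tens y x).

Definition tassoc U V W : tensor U (tensor V W) -> tensor (tensor U V) W :=
  tens_lift (fun x t => tens_lift (fun y z => tens (tens x y) z) t).

Lemma tmapE U V W X (f : U -> W) (g : V -> X) x y : linear f -> linear g ->
  tmap f g (tens x y) = tens (f x) (g y).
Proof.
move=> fL gL; apply: tens_liftE; have [tl tr] := @tens_bilinear W X.
by split=> [v a u u' | u a v v'] /=; rewrite ?fL ?gL; [exact: tl | exact: tr].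
Qed.

Lemma tauE V W (x : V) (y : W) : tau (tens x y) = tens y x.
Proof.
apply: tens_liftE; have [tl tr] := @tens_bilinear W V.
by split=> [v a u u' | u a v v'] /=; [exact: tr | exact: tl].
Qed.

Lemma tassocE U V W (x : U) (y : V) (z : W) :
  tassoc (tens x (tens y z)) = tens (tens x y) z.
Proof.
have [tl tr] := @tens_bilinear U V.
have [tl' tr'] := @tens_bilinear (tensor U V) W.
have hB u : bilinear_map (fun y z => @tens (tensor U V) W (@tens U V u y) z).
  split=> [w a v v' | v a w w'] /=; last exact: tr'.
  by have /= -> := tr u a v v'; exact: tl'.
rewrite /tassoc tens_liftE; first by rewrite tens_liftE.
split=> [t a u u' | u a t t'] /=; last exact: tens_lift_linear.
rewrite /tens_lift scaler_sumr -big_split /=.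
apply: eq_bigr => i _; rewrite scaler_sumr -big_split /=.
apply: eq_bigr => j _; have /= -> := tl (vbasis {:V})`_i a u u'.
by have /= -> := tl' (vbasis {:W})`_j a _ _; rewrite scalerDr !scalerA mulrC.
Qed.

End TensorProduct.

Section Duals.

Variable K : fieldType.
Implicit Types A V : vectType K.

Definition dualv V : vectType K := 'Hom(V, K^o).

Definition transpose V (phi : V -> V) (f : dualv V) : dualv V :=
  linfun (fun v => f (phi v) : K^o).

Lemma transposeE V (phi : V -> V) f v :
  linear phi -> transpose phi f v = f (phi v).
Proof.
move=> phiL; have hL : linear (fun v => f (phi v) : K^o).
  by move=> a x y; rewrite phiL linearP.
pose g : {linear V -> K^o} := HB.pack (fun v => f (phi v) : K^o)
  (GRing.isLinear.Build K V K^o *:%R _ hL).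
exact: (lfunE g v).
Qed.

(* The sign makes this the dual of a representation of A on V. *)
Definition dual_rep A V (phi : A -> V -> V) : A -> dualv V -> dualv V :=
  fun a f => - transpose (phi a) f.

Definition dual_basis V n (e : n.-tuple V) (i : 'I_n) : dualv V :=
  linfun (coord e i : V -> K^o).

Lemma dual_basisE V n (e : n.-tuple V) (i j : 'I_n) :
  basis_of {:V} e -> dual_basis e i e`_j = (i == j)%:R.
Proof.
by move=> he; rewrite lfunE /= coord_free ?(basis_free he) // eq_sym.
Qed.

Definition sum_transpose V (f g : V -> V) (x : V * dualv V) : V * dualv V :=
  (f x.1, transpose g x.2).

Definition semidirect A V (m : A -> A -> A) (l r : A -> V -> V)
    (x y : A * V) : A * V :=
  (m x.1 y.1, l x.1 y.2 + r y.1 x.2).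

End Duals.

Section Structures.

Variables (K : fieldType) (A : vectType K).
Implicit Types (m : A -> A -> A) (D Q : A -> A) (Delta : A -> tensor A A).

Definition Lmul m (a b : A) : A := m a b.
Definition Rmul m (a b : A) : A := m b a.
Definition symmul m (a b : A) : A := m a b + m b a.

Definition derivation m D : Prop :=
  linear D /\ forall a b, D (m a b) = m (D a) b + m a (D b).

Definition zinbiel m : Prop :=
  bilinear_map m /\
  forall a b c, m a (m b c) = m (m b a) c + m (m a b) c.

Record adm_diff_zinbiel m D Q : Prop := AdmDiffZinbiel {
  adz_zinbiel : zinbiel m;
  adz_linD : linear D;
  adz_linQ : linear Q;
  adz_D : forall a b, D (m a b) = m a (D b) + m (D a) b;
  adz_Ql : forall a b, Q (m a b) = m (Q a) b - m a (D b);
  adz_Qr : forall a b, Q (m a b) = m a (Q b) - m (D a) b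
}.

Record adm_comm_diff m D Q : Prop := AdmCommDiff {
  acd_bilinear : bilinear_map m;
  acd_comm : forall a b, m a b = m b a;
  acd_assoc : forall a b c, m a (m b c) = m (m a b) c;
  acd_D : derivation m D;
  acd_linQ : linear Q;
  acd_Q : forall a b, Q (m a b) = m (Q a) b - m a (D b)
}.

Record pre_novikov (lhd rhd : A -> A -> A) : Prop := PreNovikov {
  pn_bilinear_lhd : bilinear_map lhd;
  pn_bilinear_rhd : bilinear_map rhd;
  pn_rhd_rhd : forall a b c,
    rhd a (rhd b c) = rhd (rhd a b + lhd a b) c + rhd b (rhd a c)
                      - rhd (rhd b a + lhd b a) c;
  pn_rhd_lhd : forall a b c,
    rhd a (lhd b c) = lhd (rhd a b) c + lhd b (lhd a c + rhd a c)
                      - lhd (lhd b a) c;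
  pn_add_rhd : forall a b c, rhd (lhd a b + rhd a b) c = lhd (rhd a c) b;
  pn_lhd_lhd : forall a b c, lhd (lhd a b) c = lhd (lhd a c) b
}.

Record novikov m : Prop := Novikov {
  nov_bilinear : bilinear_map m;
  nov_lsym : forall a b c,
    m (m a b) c - m a (m b c) = m (m b a) c - m b (m a c);
  nov_rcomm : forall a b c, m (m a b) c = m (m a c) b
}.

(* The threefold tensor power is read as tensor (tensor A A) A. *)
Definition id_tens Delta (t : tensor A A) : tensor (tensor A A) A :=
  tassoc (tmap id Delta t).
Definition tens_id Delta (t : tensor A A) : tensor (tensor A A) A :=
  tmap Delta id t.
Definition tau_id : tensor (tensor A A) A -> tensor (tensor A A) A :=
  tmap (@tau K A A) id.

Record novikov_coalg Delta : Prop := NovikovCoalg {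
  nco_linear : linear Delta;
  nco_lsym : forall a,
    id_tens Delta (Delta a) - tau_id (id_tens Delta (Delta a)) =
    tens_id Delta (Delta a) - tau_id (tens_id Delta (Delta a));
  nco_rcomm : forall a,
    tau_id (id_tens Delta (tau (Delta a))) = tens_id Delta (Delta a)
}.

Record novikov_bialg m Delta : Prop := NovikovBialg {
  nbi_alg : novikov m;
  nbi_coalg : novikov_coalg Delta;
  nbi_mul : forall a b,
    Delta (m a b) = tmap (Rmul m b) id (Delta a)
      + tmap id (Lmul (symmul m) a) (Delta b + tau (Delta b));
  nbi_star : forall a b,
    tmap (Lmul (symmul m) a) id (Delta b)
      - tmap id (Lmul (symmul m) a) (tau (Delta b)) =
    tmap (Lmul (symmul m) b) id (Delta a)
      - tmap id (Lmul (symmul m) b) (tau (Delta a));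
  nbi_R : forall a b,
    tmap id (Rmul m a) (Delta b + tau (Delta b))
      - tmap (Rmul m a) id (Delta b + tau (Delta b)) =
    tmap id (Rmul m b) (Delta a + tau (Delta a))
      - tmap (Rmul m b) id (Delta a + tau (Delta a))
}.

(* Commutative and cocommutative differential ASI bialgebra. *)
Record comm_diff_asi_bialg m (delta : A -> tensor A A) D Q : Prop :=
  CommDiffASIBialg {
  asi_alg : adm_comm_diff m D Q;
  asi_linear : linear delta;
  asi_coassoc : forall a, id_tens delta (delta a) = tens_id delta (delta a);
  asi_cocomm : forall a, delta a = tau (delta a);
  asi_Q : forall a, delta (Q a) = tmap id Q (delta a) + tmap Q id (delta a);
  asi_D : forall a, delta (D a) = tmap D id (delta a) - tmap id Q (delta a);
  asi_mul : forall a b,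
    delta (m a b) = tmap id (Lmul m a) (delta b) + tmap (Rmul m b) id (delta a);
  asi_anti : forall a b,
    (tmap (Lmul m b) id (delta a) - tmap id (Rmul m b) (delta a))
    + tau (tmap (Lmul m a) id (delta b) - tmap id (Rmul m a) (delta b)) = 0
}.

End Structures.

(* Main.v *)
Require Import Defs.
From HB Require Import structures.
From mathcomp Require Import all_boot all_order all_algebra.
From mathcomp Require Import ring.
Set Implicit Arguments.
Unset Strict Implicit.
Unset Printing Implicit Defensive.
Import GRing.Theory.
Local Open Scope ring_scope.

(** On [V = A + A^*] consider the symplectic form
    [om (a+f) (b+g) = g a - f b]. The tensor [r] is inverse to it:
    [(om y (x) om z) r = om y z]. The product of [V] satisfies a 2-cocycle
    identity with respect to [om], and this says exactly that, once [V] is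
    identified with [V^*] by [om], the product dual to the coboundary
    coproduct of [r] is the product of [V] itself:
    [(om y (x) om z) (Delta x) = om (y o z) x]. Hence the coalgebra axioms are
    the algebra axioms again, and the compatibility axioms follow from these
    by moving multiplications to their [om]-adjoints. It remains to verify the
    algebra axioms and the cocycle identity on the semi-direct products. The
    map [P = D + q Q] enters only through
    [P (a b) = a (P b) + ((1-q) D a) b = (P a) b + a ((1-q) D b)].
    The two products on [V] differ by a multiple of
    [(1 + 2 q) ((D + Q) a) b], which vanishes if [q = -1/2] and also if [Q] is
    a derivation. *)


(** * Linear and bilinear maps given as plain functions *)

Section UnbundledLinear.

Variables (K : fieldType) (U V W : vectType K).

Lemma lin_add (f : U -> V) x y : linear f -> f (x + y) = f x + f y.
Proof. by move=> fL; have := fL 1 x y; rewrite !scale1r. Qed.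

Lemma lin0 (f : U -> V) : linear f -> f 0 = 0.
Proof.
by move=> fL; apply: (addrI (f 0)); rewrite -lin_add // !addr0.
Qed.

Lemma linZ (f : U -> V) a x : linear f -> f (a *: x) = a *: f x.
Proof. by move=> fL; have := fL a x 0; rewrite lin0 // !addr0. Qed.

Lemma lin_opp (f : U -> V) x : linear f -> f (- x) = - f x.
Proof. by move=> fL; rewrite -scaleN1r linZ // scaleN1r. Qed.

Lemma lin_sum (f : U -> V) (I : finType) (F : I -> U) :
  linear f -> f (\sum_i F i) = \sum_i f (F i).
Proof.
move=> fL; apply: (big_morph f) => [x y|]; [exact: lin_add | exact: lin0].
Qed.

Lemma linear_add (f g : U -> V) :
  linear f -> linear g -> linear (fun x => f x + g x).
Proof. by move=> fL gL a x y; rewrite fL gL scalerDr addrACA. Qed.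

Lemma linear_scale (f : U -> V) (c : K) :
  linear f -> linear (fun x => c *: f x).
Proof. by move=> fL a x y; rewrite fL scalerDr !scalerA mulrC. Qed.

Lemma linear_comp (f : V -> W) (g : U -> V) :
  linear f -> linear g -> linear (fun x => f (g x)).
Proof. by move=> fL gL a x y; rewrite gL fL. Qed.

Lemma bilinearl (B : U -> V -> W) y :
  bilinear_map B -> linear (fun x => B x y).
Proof. by case=> Bl _ a x x'; exact: Bl. Qed.

Lemma bilinearr (B : U -> V -> W) x : bilinear_map B -> linear (B x).
Proof. by case=> _ Br a y y'; exact: Br. Qed.

Lemma bilinear_mapI (B : U -> V -> W) :
  (forall y, linear (fun x => B x y)) -> (forall x, linear (B x)) ->
  bilinear_map B.
Proof.
by move=> Bl Br; split=> [y a x x'|x a y y'] /=; [exact: Bl|exact: Br].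
Qed.

End UnbundledLinear.

(** * Product functionals on tensor products *)

Section TensorPairing.

Variable K : fieldType.
Implicit Types U V W X : vectType K.

Definition tpair V W (phi : V -> K^o) (psi : W -> K^o) : tensor V W -> K^o :=
  tens_lift (fun x y => phi x * psi y : K^o).

Lemma tpair_linear V W (phi : V -> K^o) (psi : W -> K^o) :
  linear (tpair phi psi).
Proof. exact: tens_lift_linear. Qed.

Lemma tpairE V W (phi : V -> K^o) (psi : W -> K^o) x y :
  linear phi -> linear psi -> tpair phi psi (tens x y) = phi x * psi y.
Proof.
move=> phiL psiL; apply: tens_liftE; apply: bilinear_mapI => z a u v.
  by rewrite phiL mulrDl -scalerAl.
by rewrite psiL mulrDr -scalerAr.
Qed.

Lemma eq_tpair V W (phi phi' : V -> K^o) (psi psi' : W -> K^o) t :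
  phi =1 phi' -> psi =1 psi' -> tpair phi psi t = tpair phi' psi' t.
Proof.
move=> e1 e2; apply: eq_bigr => i _; apply: eq_bigr => j _.
by rewrite e1 e2.
Qed.

Lemma tmap_linear U V W X (f : U -> W) (g : V -> X) : linear (tmap f g).
Proof. exact: tens_lift_linear. Qed.

Lemma tau_linear V W : linear (@tau K V W).
Proof. exact: tens_lift_linear. Qed.

Lemma tassoc_linear U V W : linear (@tassoc K U V W).
Proof. exact: tens_lift_linear. Qed.

Lemma tens_linearr V W (x : V) : linear (@tens K V W x).
Proof. exact: (bilinearr x (@tens_bilinear K V W)). Qed.

Lemma tpair_tmap U V W X (f : U -> W) (g : V -> X) phi psi t :
  linear f -> linear g -> linear phi -> linear psi ->
  tpair phi psi (tmap f g t)
  = tpair (fun x => phi (f x)) (fun y => psi (g y)) t.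
Proof.
move=> fL gL phiL psiL; move: t; apply: tens_ext => [||x y].
- exact: (linear_comp (tpair_linear _ _) (tmap_linear _ _)).
- exact: tpair_linear.
- by rewrite tmapE // !tpairE //; exact: linear_comp.
Qed.

Lemma tpair_tau V W phi psi (t : tensor V W) :
  linear phi -> linear psi -> tpair psi phi (tau t) = tpair phi psi t.
Proof.
move=> phiL psiL; move: t; apply: tens_ext => [||x y].
- exact: (linear_comp (tpair_linear _ _) (@tau_linear _ _)).
- exact: tpair_linear.
- by rewrite tauE // !tpairE // mulrC.
Qed.

Lemma tpair_tassoc U V W (phi : U -> K^o) (psi : V -> K^o) (chi : W -> K^o) t :
  linear phi -> linear psi -> linear chi ->
  tpair (tpair phi psi) chi (tassoc t) = tpair phi (tpair psi chi) t.
Proof.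
move=> phiL psiL chiL; have tL := @tpair_linear.
move: t; apply: tens_ext => [||x]; [|exact: tL|].
  exact: (linear_comp (tL _ _ _ _) (@tassoc_linear _ _ _)).
apply: (tens_ext (f := fun s => _ (tassoc (tens x s)))
                 (g := fun s => _ (tens x s))) => [||y z].
- apply: (linear_comp (tL _ _ _ _)).
  exact: (linear_comp (@tassoc_linear _ _ _) (tens_linearr _)).
- exact: (linear_comp (tL _ _ _ _) (tens_linearr _)).
- by rewrite tassocE !tpairE ?mulrA.
Qed.

Definition separating V (I : Type) (phi : I -> V -> K^o) : Prop :=
  (forall i, linear (phi i)) /\
  forall x y, (forall i, phi i x = phi i y) -> x = y.

(** One factor is contracted at a time. The contractions of [s] and [t] by [psi j] lie in [V] and
    agree there because [phi] separates; hence, as [psi] separates, the contractions by coordinate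
    functionals of [V] agree in [W], and these contain all coefficients. The index types are
    arbitrary, so the lemma can be iterated to reach threefold tensors. *)
Lemma separating_tensor V W (I J : Type)
    (phi : I -> V -> K^o) (psi : J -> W -> K^o) :
  separating phi -> separating psi ->
  separating (fun p : I * J => tpair (phi p.1) (psi p.2)).
Proof.
move=> [phiL phiS] [psiL psiS].
split=> [p | s t st]; first exact: tpair_linear.
pose cl (chi : V -> K^o) := tens_lift (fun (x : V) (y : W) => chi x *: y).
pose cr (chi : W -> K^o) := tens_lift (fun (x : V) (y : W) => chi y *: x).
have clE chi eta u : linear chi -> linear eta ->
    eta (cl chi u) = tpair chi eta u.
  move=> chiL etaL; move: u; apply: tens_ext => [||x y]; last 1 first.
  - rewrite /cl tens_liftE ?tpairE ?linZ //.
    apply: bilinear_mapI => z a u v /=.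
      by rewrite chiL scalerDl scalerA.
    by rewrite scalerDr !scalerA mulrC.
  - exact: (linear_comp etaL (tens_lift_linear _)).
  - exact: tpair_linear.
have crE chi eta u : linear chi -> linear eta ->
    eta (cr chi u) = tpair eta chi u.
  move=> chiL etaL; move: u; apply: tens_ext => [||x y]; last 1 first.
  - rewrite /cr tens_liftE ?tpairE ?linZ //; first exact: mulrC.
    apply: bilinear_mapI => z a u v /=.
      by rewrite scalerDr !scalerA mulrC.
    by rewrite chiL scalerDl scalerA.
  - exact: (linear_comp etaL (tens_lift_linear _)).
  - exact: tpair_linear.
have crst j : cr (psi j) s = cr (psi j) t.
  by apply: phiS => i; rewrite !crE //; exact: (st (i, j)).
have coordL (U : vectType K) i : linear (coord (vbasis {:U}) i : U -> K^o).
  by move=> a x y; rewrite linearP.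
have clst i : cl (coord (vbasis {:V}) i) s = cl (coord (vbasis {:V}) i) t.
  apply: psiS => j; rewrite !clE //; try exact: coordL.
  by rewrite -!crE ?crst //; exact: coordL.
have coordE (u : tensor V W) i j :
    (u : 'M_(_, _)) i j = coord (vbasis {:W}) j (cl (coord (vbasis {:V}) i) u).
  rewrite (@clE _ (coord (vbasis {:W}) j : W -> K^o)); try exact: coordL.
  move: u.
  apply: (tens_ext (f := fun u : tensor V W => (u : 'M_(_, _)) i j : K^o)).
  - by move=> a x y; rewrite !mxE.
  - exact: tpair_linear.
  - by move=> x y; rewrite mxE tpairE //; exact: coordL.
by apply/matrixP=> i j; rewrite !coordE clst.
Qed.

End TensorPairing.

(** * A skew form representing all functionals, and products dual to coproducts *)

Section SymplecticForm.

Variables (K : fieldType) (V : vectType K) (om : V -> V -> K^o).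
Hypothesis om_bilinear : bilinear_map om.
Hypothesis om_skew : forall x y, om x y = - om y x.
Hypothesis om_represents :
  forall phi : V -> K^o, linear phi -> exists x, phi =1 om x.

Let omL x : linear (om x). Proof. exact: bilinearr. Qed.
Let omDl x y z : om (x + y) z = om x z + om y z.
Proof. exact: (lin_add _ _ (bilinearl z om_bilinear)). Qed.
Let omNl x y : om (- x) y = - om x y.
Proof. exact: (lin_opp _ (bilinearl y om_bilinear)). Qed.

Definition pair2 y z (t : tensor V V) : K^o := tpair (om y) (om z) t.

Definition pair3 x y z (t : tensor (tensor V V) V) : K^o :=
  tpair (pair2 x y) (om z) t.

(** By [om_represents] each coordinate functional is some [om z]. *)
Lemma separating_om : separating om.
Proof.
split=> // x y xy; rewrite (coord_vbasis (memvf x)) (coord_vbasis (memvf y)).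
apply: eq_bigr => i _; congr (_ *: _).
have [a x' y'|z Ez] := @om_represents (coord (vbasis {:V}) i).
  by rewrite linearP.
by rewrite !Ez xy.
Qed.

Lemma pair2_linear y z : linear (pair2 y z).
Proof. exact: tpair_linear. Qed.

Lemma pair3_linear x y z : linear (pair3 x y z).
Proof. exact: tpair_linear. Qed.

Lemma pair2_inj t s : (forall y z, pair2 y z t = pair2 y z s) -> t = s.
Proof.
move=> ts; apply: (separating_tensor separating_om separating_om).2 => p.
exact: ts.
Qed.

Lemma pair3_inj t s : (forall x y z, pair3 x y z t = pair3 x y z s) -> t = s.
Proof.
move=> ts; have sep2 := separating_tensor separating_om separating_om.
by apply: (separating_tensor sep2 separating_om).2 => p; exact: ts.
Qed.

Lemma pair2D y z s t : pair2 y z (s + t) = pair2 y z s + pair2 y z t.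
Proof. exact: (lin_add _ _ (pair2_linear y z)). Qed.

Lemma pair2N y z t : pair2 y z (- t) = - pair2 y z t.
Proof. exact: (lin_opp _ (pair2_linear y z)). Qed.

Lemma pair3D x y z s t : pair3 x y z (s + t) = pair3 x y z s + pair3 x y z t.
Proof. exact: (lin_add _ _ (pair3_linear x y z)). Qed.

Lemma pair3N x y z t : pair3 x y z (- t) = - pair3 x y z t.
Proof. exact: (lin_opp _ (pair3_linear x y z)). Qed.

(** Used to move an operator from a tensor factor onto a test vector. The adjoint vector is produced
    for one [y] at a time, so no adjoint operator has to be constructed. *)
Lemma adjoint_ex (f : V -> V) : linear f ->
  forall y, exists y', forall z, om y (f z) = om y' z.
Proof. by move=> fL y; apply: om_represents; apply: (linear_comp (omL y)). Qed.

Lemma pair2_tau y z t : pair2 y z (tau t) = pair2 z y t.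
Proof. exact: tpair_tau. Qed.

Lemma pair3_tau_id x y z t : pair3 x y z (tau_id t) = pair3 y x z t.
Proof.
rewrite /pair3 tpair_tmap //; [|exact: tau_linear|exact: pair2_linear].
by apply: eq_tpair => // u; exact: pair2_tau.
Qed.

Lemma pair2_tmapl (f : V -> V) y y' z t : linear f ->
  (forall u, om y (f u) = om y' u) -> pair2 y z (tmap f id t) = pair2 y' z t.
Proof. by move=> fL yy'; rewrite /pair2 tpair_tmap //; exact: eq_tpair. Qed.

Lemma pair2_tmapr (f : V -> V) y z z' t : linear f ->
  (forall u, om z (f u) = om z' u) -> pair2 y z (tmap id f t) = pair2 y z' t.
Proof. by move=> fL zz'; rewrite /pair2 tpair_tmap //; exact: eq_tpair. Qed.

Section DualProduct.

Variables (m : V -> V -> V) (Delta : V -> tensor V V).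
Hypothesis DeltaE : forall x y z, pair2 y z (Delta x) = om (m y z) x.

Lemma coproduct_linear : linear Delta.
Proof.
move=> a u v; apply: pair2_inj => y z; rewrite pair2_linear !DeltaE.
exact: omL.
Qed.

(** This and [pair3_id_tens] turn iterated coproducts into iterated products of the test vectors, so
    that a coalgebra axiom becomes an algebra axiom in [x], [y], [z]. *)
Lemma pair3_tens_id x y z t :
  pair3 x y z (tens_id Delta t) = pair2 (m x y) z t.
Proof.
rewrite /pair3 /tens_id tpair_tmap //;
  [|exact: coproduct_linear|exact: pair2_linear].
by apply: eq_tpair => // u; exact: DeltaE.
Qed.

Lemma pair3_id_tens x y z t :
  pair3 x y z (id_tens Delta t) = pair2 x (m y z) t.
Proof.
rewrite /pair3 /id_tens tpair_tassoc // tpair_tmap //;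
  [|exact: coproduct_linear|exact: pair2_linear].
by apply: eq_tpair => // u; exact: DeltaE.
Qed.

End DualProduct.

(** * Novikov algebras with a 2-cocycle identity *)

Section Novikov.

Variables (m : V -> V -> V) (Delta : V -> tensor V V).
Hypothesis m_novikov : novikov m.
Hypothesis m_cocycle :
  forall x y z, om (m x z) y + om (m y z) x = om (symmul m x y) z.
Hypothesis DeltaE : forall x y z, pair2 y z (Delta x) = om (m y z) x.

Let mlL y : linear (m^~ y).
Proof. exact: (bilinearl _ (nov_bilinear m_novikov)). Qed.
Let mrL x : linear (m x).
Proof. exact: (bilinearr _ (nov_bilinear m_novikov)). Qed.
Let starL x : linear (symmul m x). Proof. exact: linear_add. Qed.

(** The cocycle identity trades [om (m y z) x] for terms in which [x] is a multiplier, to which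
    adjoint vectors apply. *)
Lemma pair2_coproduct x y z :
  pair2 y z (Delta x) = om y (m x z) + om (symmul m x y) z.
Proof. by rewrite DeltaE -m_cocycle [om y _]om_skew addKr. Qed.

(** Symmetrizing gives [om (symmul m y z) x], which the cocycle identity splits into products with
    [x] on the right only. *)
Lemma pair2_sym_coproduct x y z :
  pair2 y z (Delta x + tau (Delta x)) = om (m y x) z - om y (m z x).
Proof.
rewrite [om y _]om_skew opprK pair2D pair2_tau !DeltaE m_cocycle.
by rewrite /symmul omDl.
Qed.

Lemma symmulC x y : symmul m x y = symmul m y x.
Proof. exact: addrC. Qed.

Lemma novikov_lsym_swap a b c :
  m a (m b c) - m b (m a c) = m (m a b) c - m (m b a) c.
Proof.
rewrite -[m (m a b) c](subrK (m a (m b c))) (nov_lsym m_novikov).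
by rewrite [RHS]addrAC [X in _ = X - _ + _]addrC addrK addrC.
Qed.

(** By right commutativity [(b c) a = (b a) c], and left symmetry says exactly that
    [a (b c) + (b a) c] is symmetric in [a] and [b]. *)
Lemma novikov_star_lcomm a b c : symmul m a (m b c) = symmul m b (m a c).
Proof.
rewrite /symmul (nov_rcomm m_novikov b c a) (nov_rcomm m_novikov a c b).
by rewrite -[m a _](subrK (m b (m a c))) novikov_lsym_swap addrAC subrK addrC.
Qed.

Theorem novikov_bialg_of_cocycle : novikov_bialg m Delta.
Proof.
have adjoint_m a y : exists y', forall w, om y (m w a) = om y' w.
  exact: adjoint_ex (mlL a) y.
have adjoint_star a y : exists y', forall w, om y (symmul m a w) = om y' w.
  exact: adjoint_ex (starL a) y.
split=> [//||a b|a b|a b];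
  first (split=> [|a|a]; first exact: coproduct_linear DeltaE).
- apply: pair3_inj => x y z; rewrite !pair3D !pair3N !pair3_tau_id.
  rewrite !(pair3_id_tens DeltaE) !(pair3_tens_id DeltaE).
  rewrite !DeltaE -!omNl -!omDl; congr (om _ _).
  exact: novikov_lsym_swap.
- apply: pair3_inj => x y z; rewrite pair3_tau_id.
  rewrite (pair3_id_tens DeltaE) (pair3_tens_id DeltaE).
  by rewrite pair2_tau !DeltaE (nov_rcomm m_novikov).
- apply: pair2_inj => y z; have [y' yE] := adjoint_m b y.
  have [z' zE] := adjoint_star a z.
  rewrite pair2D (pair2_tmapl _ _ (mlL b) yE) (pair2_tmapr _ _ (starL a) zE).
  rewrite pair2_sym_coproduct !pair2_coproduct -yE (nov_rcomm m_novikov a z).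
  rewrite -addrA; congr (_ + _).
  (* Two terms reduce to [om y' z'] with opposite signs and cancel. What remains is
     [symmul m y (m a b) = symmul m a (m y b)]. *)
  rewrite [om (symmul m a y') z]om_skew zE -[in RHS]om_skew -yE addrC subrK.
  by rewrite symmulC novikov_star_lcomm om_skew zE -om_skew.
- apply: pair2_inj => y z.
  have [y1 y1E] := adjoint_star a y; have [y2 y2E] := adjoint_star b y.
  have [z1 z1E] := adjoint_star a z; have [z2 z2E] := adjoint_star b z.
  rewrite !pair2D !pair2N.
  rewrite (pair2_tmapl _ _ (starL a) y1E) (pair2_tmapl _ _ (starL b) y2E).
  rewrite (pair2_tmapr _ _ (starL a) z1E) (pair2_tmapr _ _ (starL b) z2E).
  rewrite !pair2_tau !pair2_coproduct -y1E -y2E -z1E -z2E.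
  (* This matches the iterated products on the two sides. The other terms become values of [om] on
     adjoint vectors and match by skew symmetry. *)
  rewrite !(novikov_star_lcomm a b).
  rewrite [om (symmul m b y1) z]om_skew [om (symmul m b z1) y]om_skew.
  rewrite [om (symmul m a y2) z]om_skew [om (symmul m a z2) y]om_skew.
  rewrite !y1E !y2E !z1E !z2E [om z1 y2]om_skew [om y1 z2]om_skew.
  ring.
- apply: pair2_inj => y z.
  have [y1 y1E] := adjoint_m a y; have [y2 y2E] := adjoint_m b y.
  have [z1 z1E] := adjoint_m a z; have [z2 z2E] := adjoint_m b z.
  rewrite [LHS]pair2D [RHS]pair2D !pair2N.
  rewrite (pair2_tmapl _ _ (mlL a) y1E) (pair2_tmapl _ _ (mlL b) y2E).
  rewrite (pair2_tmapr _ _ (mlL a) z1E) (pair2_tmapr _ _ (mlL b) z2E).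
  rewrite !pair2_sym_coproduct -y1E -y2E.
  rewrite [om (m y b) z1]om_skew [om (m y a) z2]om_skew.
  rewrite [om (m y1 b) z]om_skew [om (m y2 a) z]om_skew.
  (* The same pattern, with right commutativity matching the iterated products. *)
  rewrite -z1E -z2E !(nov_rcomm m_novikov _ a b) !y1E !z1E !y2E !z2E.
  rewrite [om z2 y1]om_skew [om y2 z1]om_skew.
  ring.
Qed.

End Novikov.

(** * Commutative differential algebras with a cyclic cocycle identity *)

Section CommutativeAlgebra.

Variables (m : V -> V -> V) (D Q : V -> V) (delta : V -> tensor V V).
Hypothesis m_adm : adm_comm_diff m D Q.
Hypothesis m_cocycle :
  forall x y z, om (m x y) z + om (m y z) x = - om (m x z) y.
Hypothesis DQ_adjoint : forall x y, om x (D y) = om (Q x) y.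
Hypothesis deltaE : forall x y z, pair2 y z (delta x) = om (m y z) x.

Let mC := acd_comm m_adm.
Let mA := acd_assoc m_adm.
Let mrL x : linear (m x).
Proof. exact: (bilinearr _ (acd_bilinear m_adm)). Qed.

Lemma comm_pair2_coproduct x y z :
  pair2 y z (delta x) = om y (m x z) - om (m x y) z.
Proof. by rewrite deltaE (om_skew y) -m_cocycle addrC addKr. Qed.

Theorem comm_diff_asi_bialg_of_cocycle : comm_diff_asi_bialg m delta D Q.
Proof.
have [DL DM] := acd_D m_adm; have QL := acd_linQ m_adm.
(* [D] and [Q] are adjoint to each other. Hence the derivation rule for [D] becomes the
   compatibility of [delta] with [Q], and the rule [acd_Q] becomes the one with [D]. *)
have QD_adjoint x y : om x (Q y) = om (D x) y.
  by rewrite om_skew -DQ_adjoint -om_skew.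
have adjoint_m a y : exists y', forall w, om y (m a w) = om y' w.
  exact: adjoint_ex (mrL a) y.
(* Stated for any [f] pointwise equal to [m a], so that commutativity lets it cover [Rmul] as well
   as [Lmul]. *)
have mrE f a y y' z t : (forall w, f w = m a w) ->
    (forall w, om y (m a w) = om y' w) ->
    pair2 y z (tmap f id t) = pair2 y' z t /\
    pair2 z y (tmap id f t) = pair2 z y' t.
  move=> fE yE; have fL : linear f by move=> c u v; rewrite !fE mrL.
  by split; [apply: pair2_tmapl|apply: pair2_tmapr] => // w; rewrite fE.
split=> [//||a|a|a|a|a b|a b].
- exact: coproduct_linear deltaE.
- apply: pair3_inj => x y z; rewrite (pair3_id_tens deltaE).
  by rewrite (pair3_tens_id deltaE) !deltaE mA.
- by apply: pair2_inj => y z; rewrite pair2_tau !deltaE mC.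
- apply: pair2_inj => y z; rewrite pair2D.
  rewrite (pair2_tmapl _ _ QL (QD_adjoint y)).
  rewrite (pair2_tmapr _ _ QL (QD_adjoint z)).
  by rewrite !deltaE -omDl QD_adjoint DM addrC.
- apply: pair2_inj => y z; rewrite pair2D pair2N.
  rewrite (pair2_tmapl _ _ DL (DQ_adjoint y)).
  rewrite (pair2_tmapr _ _ QL (QD_adjoint z)).
  by rewrite !deltaE -omNl -omDl DQ_adjoint (acd_Q m_adm).
- apply: pair2_inj => y z; rewrite pair2D.
  have [y' yE] := adjoint_m b y; have [z' zE] := adjoint_m a z.
  rewrite (mrE (Rmul m b) b y y' _ _ _ yE).1 => [|w]; last exact: mC.
  rewrite (mrE (Lmul m a) a z z' _ _ _ zE).2 //.
  rewrite !comm_pair2_coproduct [om (m a y') z]om_skew [om (m b y) z']om_skew.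
  rewrite [om (m (m a b) y) z]om_skew -[m (m a b) y]mA (mC a b) -mA !yE !zE.
  rewrite [om z' y']om_skew; ring.
- apply: pair2_inj => y z; rewrite !pair2D !pair2N pair2_tau !pair2D !pair2N.
  have [y1 y1E] := adjoint_m a y; have [y2 y2E] := adjoint_m b y.
  have [z1 z1E] := adjoint_m a z; have [z2 z2E] := adjoint_m b z.
  rewrite (mrE (Lmul m b) b y y2 _ _ _ y2E).1 //.
  rewrite (mrE (Rmul m b) b z z2 _ _ _ z2E).2 => [|w]; last exact: mC.
  rewrite (mrE (Lmul m a) a z z1 _ _ _ z1E).1 //.
  rewrite (mrE (Rmul m a) a y y1 _ _ _ y1E).2 => [|w]; last exact: mC.
  rewrite !comm_pair2_coproduct (lin0 (pair2_linear y z)).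
  rewrite [om (m a y2) z]om_skew [om (m a y) z2]om_skew.
  rewrite [om (m b z1) y]om_skew [om (m b z) y1]om_skew -[om y2 (m a z)]y2E.
  rewrite -[om z2 (m a y)]z2E !mA (mC b a) -!mA !y1E !y2E !z1E !z2E.
  rewrite [om z1 y2]om_skew [om z2 y1]om_skew; ring.
Qed.

End CommutativeAlgebra.

(** * Coboundary coproducts of the tensor inverse to [om] *)

Section Coboundary.

Variables (m : V -> V -> V) (r : tensor V V).
Hypothesis m_bilinear : bilinear_map m.
Hypothesis rE : forall y z, pair2 y z r = om y z.

Let mrL x : linear (m x). Proof. exact: bilinearr. Qed.
Let mlL y : linear (m^~ y). Proof. exact: bilinearl. Qed.

(** As [r] is inverse to [om], moving both multiplications onto the test vectors gives
    [om y (m x z) + om (symmul m x y) z], which the cocycle identity collapses to [om (m y z) x]. *)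
Lemma pair2_novikov_coboundary :
  (forall x y z, om (m x z) y + om (m y z) x = om (symmul m x y) z) ->
  forall x y z, pair2 y z (tmap (Lmul m x) id r
    + tmap id (Lmul (symmul m) x) r) = om (m y z) x.
Proof.
move=> cocycle x y z.
have starL : linear (symmul m x) by exact: linear_add.
have [y' yE] := adjoint_ex (mrL x) y; have [z' zE] := adjoint_ex starL z.
rewrite pair2D (pair2_tmapl _ _ (mrL x) yE) (pair2_tmapr _ _ starL zE) !rE.
rewrite -yE [om y z']om_skew -zE -[RHS](addKr (om (m x z) y)) cocycle.
by rewrite om_skew -[- om z _]om_skew.
Qed.

(** The same computation, now starting from [om y (m x z) - om (m x y) z]. *)
Lemma pair2_comm_coboundary :
  (forall x y z, om (m x y) z + om (m y z) x = - om (m x z) y) ->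
  forall x y z, pair2 y z (- (tmap id (Lmul m x) r - tmap (Lmul m x) id r))
    = om (m y z) x.
Proof.
move=> cocycle x y z.
have [y' yE] := adjoint_ex (mrL x) y; have [z' zE] := adjoint_ex (mrL x) z.
rewrite opprB pair2D pair2N (pair2_tmapl _ _ (mrL x) yE).
rewrite (pair2_tmapr _ _ (mrL x) zE) !rE.
rewrite -yE -om_skew -zE -[RHS](addKr (om (m x y) z)) cocycle.
by rewrite addrC [om z _]om_skew [om y _]om_skew.
Qed.

End Coboundary.

End SymplecticForm.

(** * The canonical symplectic form on [A + A^*] *)

Section DualPairing.

Variables (K : fieldType) (A : vectType K).

Lemma scale_regularE (c : K) (x : K^o) : c *: x = c * x.
Proof. by []. Qed.

Lemma dualD (f : dualv A) a b : f (a + b) = f a + f b.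
Proof. exact: linearD. Qed.

Lemma dualN (f : dualv A) a : f (- a) = - f a.
Proof. exact: linearN. Qed.

Lemma dualZ (f : dualv A) c a : f (c *: a) = c * f a.
Proof. exact: linearZ. Qed.

Definition dual_form (x y : A * dualv A) : K^o := y.2 x.1 - x.2 y.1.

Lemma dual_form_bilinear :
  bilinear_map (dual_form : (A * dualv A)%type -> (A * dualv A)%type -> K^o).
Proof.
apply: bilinear_mapI => [y a x x'|x a y y'];
  by rewrite /dual_form /= linearP add_lfunE scale_lfunE scalerBr opprD addrACA.
Qed.

Lemma dual_form_skew x y : dual_form x y = - dual_form y x.
Proof. by rewrite /dual_form opprB. Qed.

Section Basis.

Variables (n : nat) (e : n.-tuple A).
Hypothesis he : basis_of {:A} e.

Lemma basis_expand (a : A) : a = \sum_(i < n) dual_basis e i a *: e`_i.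
Proof.
rewrite {1}(coord_basis he (memvf a)); apply: eq_bigr => i _.
by rewrite lfunE.
Qed.

Lemma dual_basis_expand (f : dualv A) :
  f = \sum_(i < n) f e`_i *: dual_basis e i.
Proof.
apply/lfunP => v; rewrite {1}[v]basis_expand linear_sum sum_lfunE.
by apply: eq_bigr => i _; rewrite linearZ scale_lfunE; exact: mulrC.
Qed.

Lemma dual_form_represents (phi : (A * dualv A)%type -> K^o) :
  linear phi -> exists x, phi =1 dual_form x.
Proof.
move=> phiL; pose AA : vectType K := (A * dualv A)%type.
have inlL : linear (fun a : A => (a, 0) : AA).
  by move=> c u v; congr (_, _); rewrite /= scaler0 addr0.
have inrL : linear (fun f : dualv A => (0, f) : AA).
  by move=> c u v; congr (_, _); rewrite /= scaler0 addr0.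
(* Since [dual_form x (a, f) = f x.1 - x.2 a], the values of [phi] on the dual basis are the
   coordinates of [x.1], and those on [e] are the coordinates of [x.2] with a minus sign. *)
exists (\sum_(i < n) phi (0, dual_basis e i) *: e`_i,
        \sum_(i < n) (- phi (e`_i, 0)) *: dual_basis e i) => -[a f].
rewrite /dual_form /= linear_sum sum_lfunE.
have -> : (a, f) = (a, 0) + (0, f) :> AA.
  by congr (_, _); rewrite /= ?addr0 ?add0r.
rewrite (lin_add _ _ phiL) addrC {1}[f]dual_basis_expand {1}[a]basis_expand.
rewrite (lin_sum _ (linear_comp phiL inlL)) (lin_sum _ (linear_comp phiL inrL)).
congr (_ + _).
  by apply: eq_bigr => i _; rewrite (linZ _ _ (linear_comp phiL inrL)) linearZ;
    exact: mulrC.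
rewrite -sumrN; apply: eq_bigr => i _.
rewrite (linZ _ _ (linear_comp phiL inlL)) scale_lfunE scaleNr opprK.
exact: mulrC.
Qed.

(** This makes [r] inverse to the form: expand [y.1] and [z.1] in the basis and compare term by
    term. *)
Lemma pair2_canonical (y z : (A * dualv A)%type) :
  pair2 dual_form y z
   (\sum_(i < n) (tens (e`_i, 0) (0, dual_basis e i)
                  - tens (0, dual_basis e i) (e`_i, 0))) = dual_form y z.
Proof.
have omL x := bilinearr x dual_form_bilinear.
rewrite (lin_sum _ (pair2_linear _ y z)).
have -> : dual_form y z = \sum_(i < n) (dual_basis e i y.1 * z.2 e`_i
                                       - dual_basis e i z.1 * y.2 e`_i).
  rewrite /dual_form {1}(basis_expand y.1) {1}(basis_expand z.1) !linear_sum.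
  rewrite -big_split; apply: eq_bigr => i _; rewrite /= !linearZ /=.
  by rewrite scalerN.
apply: eq_bigr => i _; rewrite (lin_add _ _ (pair2_linear _ y z)).
rewrite (lin_opp _ (pair2_linear _ y z)) /pair2 !tpairE //.
rewrite /dual_form /= !linear0 !zero_lfunE.
ring.
Qed.

End Basis.
End DualPairing.

(** * Zinbiel algebras and the commutative semidirect product *)

Section Zinbiel.

Variables (K : fieldType) (A : vectType K) (zb : A -> A -> A).
Hypothesis zbZ : zinbiel zb.

Let zbl y : linear (zb^~ y).
Proof. by case: zbZ => zbB _; exact: bilinearl. Qed.
Let zbr x : linear (zb x).
Proof. by case: zbZ => zbB _; exact: bilinearr. Qed.
Let zbDl x y z : zb (x + y) z = zb x z + zb y z.
Proof. exact: (lin_add _ _ (zbl z)). Qed.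
Let zbDr x y z : zb x (y + z) = zb x y + zb x z.
Proof. exact: (lin_add _ _ (zbr x)). Qed.

Definition zdot (a b : A) : A := zb a b + zb b a.

(** The Zinbiel identity in operator form: left multiplications represent the commutative algebra
    [zdot]. In particular they commute, which is [zb_lcomm]. *)
Lemma zb_zdot a b c : zb (zdot a b) c = zb a (zb b c).
Proof. by rewrite zbZ.2 zbDl addrC. Qed.

Lemma zb_lcomm a b c : zb a (zb b c) = zb b (zb a c).
Proof. by rewrite -!zb_zdot; congr zb; exact: addrC. Qed.

Lemma zdot_bilinear : bilinear_map zdot.
Proof. by apply: bilinear_mapI => x; exact: linear_add. Qed.

Lemma zdotC a b : zdot a b = zdot b a.
Proof. exact: addrC. Qed.

Lemma zdotA a b c : zdot a (zdot b c) = zdot (zdot a b) c.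
Proof.
rewrite {1 3}/zdot !zb_zdot /zdot !zbDr addrA.
by rewrite [zb a (zb c b)]zb_lcomm [zb b (zb c a)]zb_lcomm.
Qed.

Definition zsemi : A * dualv A -> A * dualv A -> A * dualv A :=
  semidirect zdot (fun a f => - dual_rep (Lmul zb) a f)
                  (fun a f => - dual_rep (Lmul zb) a f).

Lemma zsemiE x y v :
  (zsemi x y).2 v = y.2 (zb x.1 v) + x.2 (zb y.1 v).
Proof. by rewrite /= /dual_rep !opprK add_lfunE !transposeE //; exact: zbr. Qed.

Lemma dual_eqP (x y : A * dualv A) :
  x.1 = y.1 -> (forall v, x.2 v = y.2 v) -> x = y.
Proof.
by case: x y => [a f] [b g] /= -> fg; congr (_, _); apply/lfunP.
Qed.

Lemma zsemi_bilinear :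
  bilinear_map (zsemi : (A * dualv A)%type -> _ -> (A * dualv A)%type).
Proof.
have [dl dr] := zdot_bilinear.
apply: bilinear_mapI => [y c x x'|x c y y']; apply: dual_eqP => [|v].
- exact: dl.
- rewrite [RHS]add_lfunE scale_lfunE !zsemiE add_lfunE scale_lfunE /=.
  rewrite (zbl v c) linearP scalerDr -!addrA; congr (_ + _).
  by rewrite addrCA.
- exact: dr.
- rewrite [RHS]add_lfunE scale_lfunE !zsemiE add_lfunE scale_lfunE /=.
  rewrite (zbl v c) linearP scalerDr -!addrA; congr (_ + _).
  by rewrite addrCA.
Qed.

(** With all terms on one side, [z.2] is applied to [zdot x.1 y.1 - zb x.1 y.1 - zb y.1 x.1 = 0],
    and likewise for [x.2] and [y.2]. *)
Lemma zsemi_cocycle x y z :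
  dual_form (zsemi x y) z + dual_form (zsemi y z) x
  = - dual_form (zsemi x z) y.
Proof. rewrite /dual_form !zsemiE /= /zdot !dualD; ring. Qed.

(** * Admissible differentials on the semidirect product *)

Section Differential.

Variables D Q : A -> A.
Hypothesis admDQ : adm_diff_zinbiel zb D Q.

Let DL : linear D. Proof. exact: adz_linD admDQ. Qed.
Let QL : linear Q. Proof. exact: adz_linQ admDQ. Qed.

Lemma zdot_adm_comm_diff : adm_comm_diff zdot D Q.
Proof.
have DD := lin_add _ _ DL; have QD := lin_add _ _ QL.
split; [exact: zdot_bilinear|exact: zdotC|exact: zdotA| |exact: QL|].
  split=> // a b; rewrite /zdot DD !(adz_D admDQ).
  by rewrite [zb a _ + _]addrC addrACA.
move=> a b; rewrite /zdot QD (adz_Ql admDQ) [Q (zb b a)](adz_Qr admDQ).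
by rewrite addrACA -opprD.
Qed.

(** On the dual component, [adz_Qr] transposes to the derivation rule for [D + Q^*], while [adz_Ql]
    and [adz_D] transpose to the rule for [Q + D^*]. *)
Lemma zsemi_adm_comm_diff :
  adm_comm_diff (zsemi : (A * dualv A)%type -> _ -> (A * dualv A)%type)
    (sum_transpose D Q) (sum_transpose Q D).
Proof.
have DD := lin_add _ _ DL; have QD := lin_add _ _ QL.
have st_linear (f g : A -> A) : linear f -> linear g ->
    linear (sum_transpose f g : (A * dualv A)%type -> (A * dualv A)%type).
  move=> fL gL c x y; apply: dual_eqP => [|v]; first exact: fL.
  by rewrite /= !(transposeE, add_lfunE, scale_lfunE).
have [_ _ _ [_ dotD] _ dotQ] := zdot_adm_comm_diff.
split.
- exact: zsemi_bilinear.
- move=> x y; apply: dual_eqP => [|v]; first exact: zdotC.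
  by rewrite !zsemiE addrC.
- move=> x y z; apply: dual_eqP => [|v]; first exact: zdotA.
  rewrite !zsemiE /= !zb_zdot [zb z.1 (zb x.1 v)]zb_lcomm.
  by rewrite [zb y.1 (zb x.1 v)]zb_lcomm addrA.
- split=> [|x y]; first exact: st_linear.
  apply: dual_eqP => [|v]; first exact: dotD.
  rewrite [LHS]transposeE // zsemiE [RHS]add_lfunE !zsemiE /= !transposeE //.
  by rewrite !(adz_Qr admDQ) !dualD !dualN; ring.
- exact: st_linear.
- move=> x y; apply: dual_eqP => [|v]; first exact: dotQ.
  rewrite [LHS]transposeE // zsemiE [RHS]add_lfunE opp_lfunE !zsemiE /=.
  by rewrite !transposeE // !(adz_Ql admDQ) (adz_D admDQ) !dualD !dualN; ring.
Qed.

Lemma sum_transpose_adjoint (x y : A * dualv A) :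
  dual_form x (sum_transpose D Q y) = dual_form (sum_transpose Q D x) y.
Proof. by rewrite /dual_form /= !transposeE. Qed.

End Differential.

(** * Pre-Novikov and Novikov structures, with [P] for [D + q Q] and [d] for [(1 - q) D] *)

Section PreNovikov.

Variables P d : A -> A.
Hypothesis PL : linear P.
Hypothesis zbPr : forall a b, P (zb a b) = zb a (P b) + zb (d a) b.
Hypothesis zbPl : forall a b, P (zb a b) = zb (P a) b + zb a (d b).

Lemma zdotP a b : P (zdot a b) = zdot (P a) b + zdot a (d b).
Proof.
by rewrite /zdot (lin_add _ _ PL) zbPl [P (zb b a)]zbPr addrACA.
Qed.

Lemma zb_P_zdot a b c :
  zb (P (zdot a b)) c = zb (P a) (zb b c) + zb a (zb (d b) c).
Proof. by rewrite zdotP zbDl !zb_zdot. Qed.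

Definition zrhd a b := zb a (P b).
Definition zlhd a b := zb (P b) a.
Definition zcirc a b := zdot a (P b).

(** The rules for [P] and [zb_zdot] reduce the axioms to identities between iterated left
    multiplications, which commute. *)
Lemma zb_pre_novikov : pre_novikov zlhd zrhd.
Proof.
split=> [||a b c|a b c|a b c|a b c].
- apply: bilinear_mapI => x; first exact: zbr.
  exact: (linear_comp (zbl x) PL).
- apply: bilinear_mapI => x; first exact: zbl.
  exact: (linear_comp (zbr x) PL).
- rewrite /zrhd /zlhd -![zb _ _ + zb (P _) _]/(zdot _ _) !zb_zdot !zbPl !zbDr.
  by rewrite [zb b (zb a _)]zb_lcomm [zb b _ + _]addrC addrA addrK.
- rewrite /zrhd /zlhd [zb (P c) a + _]addrC -[zb a _ + _]/(zdot _ _) zdotP.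
  rewrite zbPr zbDl !zb_zdot zbDr [zb (P c) (zb a _)]zb_lcomm.
  by rewrite [zb (P c) (zb (P a) b)]zb_lcomm -addrA addrAC subrr add0r.
- by rewrite /zrhd /zlhd -[zb (P b) a + _]/(zdot _ _) zb_zdot.
- by rewrite /zlhd zb_lcomm.
Qed.

Lemma zcirc_bilinear : bilinear_map zcirc.
Proof.
have [dl dr] := zdot_bilinear.
apply: bilinear_mapI => [y c x x'|x c y y']; rewrite /zcirc ?PL.
  exact: dl.
exact: dr.
Qed.

(** The rule for [P] cancels the terms in [P b]. The result depends on [a] and [b] only through
    their commutative product, hence left symmetry. *)
Lemma zcirc_associator a b c :
  zcirc (zcirc a b) c - zcirc a (zcirc b c) = - zdot a (zdot b (d (P c))).
Proof.
rewrite /zcirc -zdotA zdotP.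
by rewrite (lin_add _ _ (bilinearr _ zdot_bilinear)) opprD addrA subrr add0r.
Qed.

Lemma zcirc_novikov : novikov zcirc.
Proof.
split; first exact: zcirc_bilinear.
  move=> a b c; rewrite !zcirc_associator !zdotA; congr (- zdot _ _).
  exact: zdotC.
by move=> a b c; rewrite /zcirc -!zdotA [zdot (P b) _]zdotC.
Qed.

Definition zcirc_semi : A * dualv A -> A * dualv A -> A * dualv A :=
  semidirect zcirc
    (fun a f => dual_rep (Lmul zrhd) a f + dual_rep (Rmul zlhd) a f)
    (fun a f => - dual_rep (Rmul zlhd) a f).

Lemma zcirc_semiE x y v :
  (zcirc_semi x y).2 v = x.2 (zb (P y.1) v)
    - y.2 (zb x.1 (P v)) - y.2 (zb (P x.1) v).
Proof.
rewrite /= /dual_rep !opprK !add_lfunE !opp_lfunE !transposeE.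
- by rewrite addrC addrA.
- exact: zbr.
- exact: zbr.
- exact: (linear_comp (zbr _) PL).
Qed.

Lemma zcirc_semi_bilinear :
  bilinear_map (zcirc_semi : (A * dualv A)%type -> _ -> (A * dualv A)%type).
Proof.
have [dl dr] := zcirc_bilinear.
apply: bilinear_mapI => [y c x x'|x c y y']; apply: dual_eqP => [|v].
- exact: dl.
- rewrite [RHS]add_lfunE scale_lfunE !zcirc_semiE !(add_lfunE, scale_lfunE) /=.
  by rewrite PL !(zbl _ c) !dualD !dualZ !scale_regularE; ring.
- exact: dr.
- rewrite [RHS]add_lfunE scale_lfunE !zcirc_semiE !(add_lfunE, scale_lfunE) /=.
  by rewrite PL !(zbl _ c) !dualD !dualZ !scale_regularE; ring.
Qed.

(** Once [zdot] is expanded, the terms in [x.2], in [y.2] and in [z.2] match separately. *)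
Lemma zcirc_semi_cocycle x y z :
  dual_form (zcirc_semi x z) y + dual_form (zcirc_semi y z) x
  = dual_form (symmul (zcirc_semi : (A * dualv A)%type -> _ -> _) x y) z.
Proof.
rewrite /dual_form /symmul [((_ + _ : (A * dualv A)%type)).2 _]add_lfunE.
rewrite !zcirc_semiE /= /zcirc /zdot !dualD; ring.
Qed.

Lemma zcirc_semi_novikov :
  novikov (zcirc_semi : (A * dualv A)%type -> _ -> (A * dualv A)%type).
Proof.
have [_ lsym rcomm] := zcirc_novikov.
split; first exact: zcirc_semi_bilinear.
  move=> x y z; apply: dual_eqP => [|v]; first exact: lsym.
  rewrite [LHS]add_lfunE [RHS]add_lfunE !opp_lfunE !zcirc_semiE /=.
  (* All arguments of the functionals are brought to sums of iterated left multiplications, in an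
     order fixed by [zb_lcomm]. Only a comparison of summands is then left. *)
  rewrite /zcirc !zb_P_zdot !zb_zdot [P (zb _ (P v))]zbPl.
  rewrite [P (zb y.1 (P v))]zbPl !zbPr !zbDr [zb y.1 (zb x.1 (d _))]zb_lcomm.
  rewrite [zb (P z.1) (zb (P x.1) v)]zb_lcomm.
  rewrite [zb (P z.1) (zb (P y.1) v)]zb_lcomm.
  rewrite [zb (P z.1) (zb x.1 _)]zb_lcomm [zb (P z.1) (zb y.1 _)]zb_lcomm.
  rewrite [zb (P y.1) (zb (P x.1) v)]zb_lcomm.
  rewrite [zb (P y.1) (zb x.1 _)]zb_lcomm [zb (P x.1) (zb y.1 _)]zb_lcomm.
  rewrite !dualD; ring.
move=> x y z; apply: dual_eqP => [|v]; first exact: rcomm.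
rewrite !zcirc_semiE /= /zcirc !zb_P_zdot !zb_zdot !zbPr !zbDr !dualD.
rewrite [zb (P z.1) (zb _ v)]zb_lcomm; ring.
Qed.

End PreNovikov.

(** * The map [D + q Q] and the comparison of the two products *)

Section Deformation.

Variables (D Q : A -> A) (q : K).
Hypothesis admDQ : adm_diff_zinbiel zb D Q.

Definition deform (f g : A -> A) (a : A) : A := f a + q *: g a.

Let DL : linear D. Proof. exact: adz_linD admDQ. Qed.
Let QL : linear Q. Proof. exact: adz_linQ admDQ. Qed.

Lemma deform_linear : linear (deform D Q).
Proof. by apply: linear_add => //; exact: linear_scale. Qed.

(** The term [- zb (D a) b] in [adz_Qr], scaled by [q], lowers the coefficient of [zb (D a) b] from
    [1] to [1 - q]. *)
Lemma zb_deformr a b :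
  deform D Q (zb a b) = zb a (deform D Q b) + zb ((1 - q) *: D a) b.
Proof.
rewrite /deform (adz_D admDQ) (adz_Qr admDQ) zbDr (linZ _ _ (zbl b)).
rewrite (linZ _ _ (zbr a)) scalerBr scalerBl scale1r -!addrA; congr (_ + _).
by rewrite addrCA.
Qed.

Lemma zb_deforml a b :
  deform D Q (zb a b) = zb (deform D Q a) b + zb a ((1 - q) *: D b).
Proof.
rewrite /deform (adz_D admDQ) (adz_Ql admDQ) zbDl (linZ _ _ (zbl b)).
rewrite (linZ _ _ (zbr a)) scalerBr scalerBl scale1r.
by rewrite [zb a (D b) + _]addrC -!addrA; congr (_ + _); rewrite addrCA.
Qed.

Lemma zsemi_deform x y :
  q = - 2%:R^-1 /\ 2%:R != 0 :> K \/ derivation zb Q ->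
  zsemi x (sum_transpose D Q y + q *: sum_transpose Q D y :> A * dualv A)
  = zcirc_semi (deform D Q) x y.
Proof.
move=> hq; apply: dual_eqP => // v; have PL := deform_linear.
rewrite zsemiE zcirc_semiE //= add_lfunE scale_lfunE !transposeE //.
rewrite /deform !zbDl zbDr !(linZ _ _ (zbl v)) (linZ _ _ (zbr x.1)).
rewrite !dualD !dualZ !scale_regularE.
have hl := congr1 y.2 (adz_Ql admDQ x.1 v).
have hr := congr1 y.2 (adz_Qr admDQ x.1 v).
rewrite dualD dualN in hl; rewrite dualD dualN hl in hr.
(* The left side is the difference of the two products at [v], after the rules for [D] and [Q] have
   removed the other terms. *)
have key : (1 + q + q) * (y.2 (zb (Q x.1) v) + y.2 (zb (D x.1) v)) = 0.
  case: hq => [[-> two0]|[_ Qder]].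
    rewrite -addrA -opprD -mulr2n -[2%:R^-1 *+ 2]mulr_natr mulVf //.
    by rewrite subrr mul0r.
  (* Under [y.2], the derivation rule and [adz_Ql] give [zb x.1 (Q v) = - zb x.1 (D v)]; then
     [adz_Qr] gives [zb (Q x.1) v = - zb (D x.1) v]. *)
  have := congr1 y.2 (Qder x.1 v); rewrite dualD hl => /addrI hd.
  by move: hr; rewrite -hd addrC => /addrI ->; rewrite addNr mulr0.
have hU : y.2 (zb x.1 (Q v)) = y.2 (zb (Q x.1) v) - y.2 (zb x.1 (D v))
                               + y.2 (zb (D x.1) v) by rewrite hr subrK.
rewrite (adz_D admDQ) dualD hl hU.
apply/eqP; rewrite -subr_eq0; apply/eqP; rewrite -[RHS]key.
ring.
Qed.

End Deformation.

End Zinbiel.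

(** * Assembly of (a), (b) and (c) *)

Theorem theorem3p37 (K : fieldType) (charK0 : [pchar K] =i pred0)
    (A : vectType K) (zb : A -> A -> A) (D Q : A -> A) (q : K)
    (hA : adm_diff_zinbiel zb D Q)
    (n : nat) (e : n.-tuple A) (he : basis_of {:A} e) :
  let AA : vectType K := (A * dualv A)%type in
  let dot : A -> A -> A := fun a b => zb a b + zb b a in
  let lhdq : A -> A -> A := fun a b => zb (D b + q *: Q b) a in
  let rhdq : A -> A -> A := fun a b => zb a (D b + q *: Q b) in
  let circq : A -> A -> A := fun a b => dot a (D b + q *: Q b) in
  let r : tensor AA AA :=
    \sum_(i < n) (tens ((e`_i, 0) : AA) ((0, dual_basis e i) : AA)
                  - tens ((0, dual_basis e i) : AA) ((e`_i, 0) : AA)) in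
  let circ : AA -> AA -> AA :=
    semidirect circq
      (fun a f => dual_rep (Lmul rhdq) a f + dual_rep (Rmul lhdq) a f)
      (fun a f => - dual_rep (Rmul lhdq) a f) in
  let Delta : AA -> tensor AA AA := fun x =>
    tmap (Lmul circ x) id r + tmap id (Lmul (symmul circ) x) r in
  let cdot : AA -> AA -> AA :=
    semidirect dot (fun a f => - dual_rep (Lmul zb) a f)
                   (fun a f => - dual_rep (Lmul zb) a f) in
  let delta : AA -> tensor AA AA := fun x =>
    - (tmap id (Lmul cdot x) r - tmap (Lmul cdot x) id r) in
  let DQ : AA -> AA := sum_transpose D Q in
  let QD : AA -> AA := sum_transpose Q D in
  let Circq : AA -> AA -> AA := fun x y => cdot x (DQ y + q *: QD y) in
  let Deltaq : AA -> tensor AA AA := fun x =>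
    tmap id (fun y => QD y + q *: DQ y) (delta x) in
  [/\ adm_comm_diff dot D Q,
      [/\ pre_novikov lhdq rhdq, novikov circq & novikov_bialg circ Delta],
      comm_diff_asi_bialg cdot delta DQ QD
    & q = - 2%:R^-1 \/ derivation zb Q ->
      [/\ novikov_bialg Circq Deltaq,
          forall x y, Circq x y = circ x y
        & forall x, Deltaq x = Delta x]].
Proof.
move=> AA dot lhdq rhdq circq r circ Delta cdot delta DQ QD Circq Deltaq.
have zbZ := adz_zinbiel hA.
have PL : linear (deform q D Q) by exact: deform_linear hA.
have Pr := zb_deformr zbZ q hA; have Pl := zb_deforml zbZ q hA.
have omB := @dual_form_bilinear K A; have omS := @dual_form_skew K A.
have omR := dual_form_represents he; have rE := pair2_canonical he.
(* The operations of the statement are convertible to [zcirc_semi] and [zsemi] with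
   [P := deform q D Q], so the general results apply directly. *)
have circN : novikov circ := zcirc_semi_novikov zbZ PL Pr Pl.
have circC := zcirc_semi_cocycle zbZ PL.
have DeltaE x y z :
    pair2 (@dual_form K A) y z (Delta x) = dual_form (circ y z) x.
  exact: (pair2_novikov_coboundary omB omS omR (nov_bilinear circN) rE circC).
have cdotA : adm_comm_diff cdot DQ QD := zsemi_adm_comm_diff zbZ hA.
have cdotC := zsemi_cocycle zbZ.
have deltaE x y z :
    pair2 (@dual_form K A) y z (delta x) = dual_form (cdot y z) x.
  exact: (pair2_comm_coboundary omB omS omR (acd_bilinear cdotA) rE cdotC).
have QD_adj := sum_transpose_adjoint hA.
split.
- exact: (zdot_adm_comm_diff zbZ hA).
- split; first exact: (zb_pre_novikov zbZ PL Pr Pl).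
    exact: (zcirc_novikov zbZ PL Pr Pl).
  exact: (novikov_bialg_of_cocycle omB omS omR circN circC DeltaE).
- exact: (comm_diff_asi_bialg_of_cocycle omB omS omR cdotA cdotC QD_adj deltaE).
move=> hq.
have CircqE x y : Circq x y = circ x y.
  apply: (zsemi_deform zbZ hA); case: hq => [qE|Qder]; [left|by right].
  (* Characteristic 0 makes [2] nonzero, so that [2%:R^-1] is a genuine inverse and not the default
     value 0. *)
  by split=> //; rewrite ((pcharf0P K).1 charK0).
(* The adjoint of [QD + q DQ] is [DQ + q QD]. Applied to the second test vector it turns the product
   dual to [delta] into [Circq], so [Deltaq] is dual to [Circq], as [Delta] is to [circ]. *)
have DeltaqE x y z :
    pair2 (@dual_form K A) y z (Deltaq x) = dual_form (Circq y z) x.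
  have DQL := (acd_D cdotA).1; have QDL := acd_linQ cdotA.
  have fL : linear (fun u : AA => QD u + q *: DQ u).
    by apply: linear_add => //; exact: linear_scale.
  have zE u : dual_form z (QD u + q *: DQ u) = dual_form (DQ z + q *: QD z) u.
    rewrite (lin_add _ _ (bilinearr z omB)) (linZ _ _ (bilinearr z omB)).
    rewrite (lin_add _ _ (bilinearl u omB)) (linZ _ _ (bilinearl u omB)).
    by rewrite (dual_form_skew _ (QD u)) -QD_adj -dual_form_skew QD_adj.
  by rewrite (pair2_tmapr omB _ _ fL zE); exact: deltaE.
(* [Circq] and [circ] are known to agree only pointwise, so the axioms are transferred one by
   one. *)
have CircqN : novikov Circq.
  split=> [|a b c|a b c]; last 2 first.
  - by rewrite !CircqE; exact: nov_lsym circN a b c.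
  - by rewrite !CircqE; exact: nov_rcomm circN a b c.
  have [cl cr] := nov_bilinear circN.
  by split=> [y c x x'|x c y y'] /=; rewrite !CircqE; [exact: cl|exact: cr].
split; [|exact: CircqE|move=> x; apply: (pair2_inj omB omR) => y z].
  apply: (novikov_bialg_of_cocycle omB omS omR CircqN _ DeltaqE) => x y z.
  by rewrite /symmul !CircqE; exact: circC.
by rewrite DeltaqE DeltaE CircqE.
Qed.
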